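(* Let $N\ge1$ and $x\in\mathbb{W}^N$. Then $$\mathfrak{h}_N(x;\lambda)=\det\left(\mathfrak{I}_{i-1}(x_j;\lambda)\right)_{i,j=1}^N,$$ where the functions $\mathfrak{I}_i$ are defined, for $x\in\mathbb{Z}_+$, by $$\mathfrak{I}_0(x;\lambda)\equiv1,\qquad \mathfrak{I}_i(x;\lambda)=\sum_{y=0}^{x-1}\frac{1}{\lambda(y)}\mathfrak{I}_{i-1}(y;\lambda)\quad(i\ge1).$$
   Context: $\mathbb{Z}_+=\{0,1,2,\dots\}$ and $\lambda:\mathbb{Z}_+\to(0,\infty)$ satisfies $0<\inf\lambda\le\sup\lambda<\infty$. $\mathbb{W}^N=\{x\in\mathbb{Z}_+^N:x_1<\dots<x_N\}$; for $y\in\mathbb{W}^N,x\in\mathbb{W}^{N+1}$, $y\prec x$ means $x_1\le y_1<x_2\le\dots<x_N\le y_N<x_{N+1}$. The functions $\mathfrak{h}_N(\cdot)=\mathfrak{h}_N(\cdot;\lambda)$ on $\mathbb{W}^N$ are defined recursively by $\mathfrak{h}_1\equiv1$ and $$\mathfrak{h}_{N+1}(x)=\sum_{y\in\mathbb{W}^N}\Lambda_N^{N+1}(x,y)\,\mathfrak{h}_N(y),\qquad \Lambda_N^{N+1}(x,y)=\prod_{i=1}^N\frac{1}{\lambda(y_i)}\,\mathbf{1}(y\prec x),\quad x\in\mathbb{W}^{N+1}.$$ Empty sums are zero. *)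

(* Defs.v *)
From mathcomp Require Import all_boot all_order all_algebra.
From mathcomp Require Import boolp classical_sets functions fsbigop reals ereal.

Set Implicit Arguments.
Unset Strict Implicit.
Unset Printing Implicit Defensive.

Import Order.TTheory GRing.Theory Num.Theory.

Local Open Scope classical_set_scope.
Local Open Scope ring_scope.

(* Coordinates are numbered from 0: (x_1, ..., x_N) is (x 0, ..., x (N - 1)). *)
Definition chamber (N : nat) : set {ffun 'I_N -> nat} :=
  [set x | forall i j : 'I_N, (i < j)%N -> (x i < x j)%N].
Arguments chamber N : clear implicits.

Definition interlaced (N : nat)
    (y : {ffun 'I_N -> nat}) (x : {ffun 'I_N.+1 -> nat}) : bool :=
  [forall i : 'I_N,
    (x (widen_ord (leqnSn N) i) <= y i)%N && (y i < x (lift ord0 i))%N].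

Definition Lambda (R : realType) (lam : nat -> R) (N : nat)
    (x : {ffun 'I_N.+1 -> nat}) (y : {ffun 'I_N -> nat}) : R :=
  (\prod_(i < N) (1 / lam (y i))) * (interlaced y x)%:R.

(* The sum over the infinite set [chamber N] is the finite-support sum of
   fsbigop: only finitely many y are interlaced with a given x.  The value at
   N = 0 is a placeholder: the recursion starts at N = 1. *)
Fixpoint hfun (R : realType) (lam : nat -> R) (N : nat) {struct N} :
    {ffun 'I_N -> nat} -> R :=
  match N return {ffun 'I_N -> nat} -> R with
  | 0 => fun=> 1
  | M.+1 =>
    match M return ({ffun 'I_M -> nat} -> R) -> {ffun 'I_M.+1 -> nat} -> R with
    | 0 => fun _ _ => 1
    | K.+1 => fun hM x =>
        \sum_(y \in chamber K.+1) (Lambda lam x y * hM y)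
    end (@hfun R lam M)
  end.

Fixpoint Ifun (R : realType) (lam : nat -> R) (i x : nat) {struct i} : R :=
  match i with
  | 0 => 1
  | k.+1 => \sum_(0 <= y < x) (1 / lam y) * Ifun lam k y
  end.

(* Main.v *)
(* Induct on N.  For x in W^(N+1), the y interlaced with x form a box
   \prod_j [x_j, x_(j+1)), automatically contained in W^N.  Determinants being
   multilinear in their columns, summing the weighted determinants
   \det (I_i (y_j) / lam (y_j)) over this box sums each column over
   [x_j, x_(j+1)), which telescopes to
   \det (I_(i+1) (x_(j+1)) - I_(i+1) (x_j)).  This is what remains of
   \det (I_i (x_j)) after subtracting from each column its left neighbour,
   since the first row is constantly 1. *)
Require Import Defs.
From mathcomp Require Import perm.
From mathcomp Require Import all_boot all_order all_algebra.
From mathcomp Require Import boolp classical_sets functions fsbigop reals ereal.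

Import Order.TTheory GRing.Theory Num.Theory.
Local Open Scope classical_set_scope.
Local Open Scope ring_scope.

(** The column subtractions are a single right multiplication by a unitriangular [U]; the first row
    of [A *m U] is (1, 0, ..., 0), so the expansion along it keeps one minor. *)
Lemma det_row1_col_diff (R : comPzRingType) (n : nat) (A : 'M[R]_n.+1) :
  (forall j, A ord0 j = 1) ->
  \det A = \det (\matrix_(i < n, j < n)
    (A (lift ord0 i) (lift ord0 j) - A (lift ord0 i) (widen_ord (leqnSn n) j))).
Proof.
move=> A1.
pose U : 'M[R]_n.+1 := \matrix_(k, j) ((k == j)%:R - (k.+1 == j :> nat)%:R).
have detU : \det U = 1.
  (* [U] is upper triangular, while [det_trig] expects a lower triangular matrix. *)
  rewrite -det_tr det_trig.
    by apply: big1 => i _; rewrite !mxE eqxx eqn_leq ltnn subr0.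
  apply/is_trig_mxP => i j ltij; rewrite !mxE -val_eqE /= (gtn_eqF ltij).
  by rewrite (gtn_eqF (ltnW _)) ?subrr // ltnS.
have AU0 i : (A *m U) i ord0 = A i ord0.
  rewrite mxE (bigD1 ord0) //= big1 => [|k k0]; rewrite !mxE.
    by rewrite eqxx subr0 mulr1 addr0.
  by rewrite (negPf k0) subrr mulr0.
have AUS i j : (A *m U) i (lift ord0 j) =
    A i (lift ord0 j) - A i (widen_ord (leqnSn n) j).
  rewrite mxE; under eq_bigr => k _ do rewrite mxE mulrBr.
  rewrite sumrB (bigD1 (lift ord0 j)) //= eqxx mulr1 big1 ?addr0; last first.
    by move=> k /negPf ->; rewrite mulr0.
  rewrite (bigD1 (widen_ord (leqnSn n) j)) //= eqxx mulr1 big1 ?addr0 //.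
  by move=> k; rewrite -val_eqE /= => /negPf kj; rewrite eqSS kj mulr0.
rewrite -[LHS]mulr1 -detU -det_mulmx (expand_det_row _ ord0) big_ord_recl.
rewrite AU0 A1 mul1r big1 => [|j _]; last by rewrite AUS !A1 subrr mul0r.
rewrite addr0 /cofactor expr0 mul1r; congr (\det _).
by apply/matrixP => i j; rewrite 2!mxE AUS mxE.
Qed.

(** In each Leibniz term the product of sums distributes over the choices [f] of one summand per
    column. *)
Lemma det_sum_cols (R : comPzRingType) (n : nat) (T : finType)
    (F : 'I_n -> 'I_n -> T -> R) :
  \det (\matrix_(i, j) \sum_t F i j t) =
  \sum_(f : {ffun 'I_n -> T}) \det (\matrix_(i, j) F i j (f j)).
Proof.
(* The transposed Leibniz formula indexes the product by columns, as [f] is. *)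
have detE (G : 'I_n -> 'I_n -> R) : \det (\matrix_(i, j) G i j) =
    \sum_(s : 'S_n) (-1) ^+ s * \prod_j G (s j) j.
  rewrite -det_tr; apply: eq_bigr => s _; congr (_ * _).
  by apply: eq_bigr => i _; rewrite !mxE.
rewrite detE (eq_bigr _ (fun f _ => detE _)) exchange_big; apply: eq_bigr => s _.
by rewrite bigA_distr_bigA big_distrr.
Qed.

Lemma det_scale_cols (R : comPzRingType) (n : nat) (c : 'I_n -> R)
    (F : 'I_n -> 'I_n -> R) :
  \det (\matrix_(i, j) (c j * F i j)) =
  (\prod_j c j) * \det (\matrix_(i, j) F i j).
Proof.
rewrite mulrC -[\prod_j c j]
  (eq_bigr _ (fun j _ => mxE _ _ ord0 j : (\row_j c j) ord0 j = c j)).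
rewrite -det_diag -det_mulmx mul_mx_diag; congr (\det _).
by apply/matrixP => i j; rewrite !mxE mulrC.
Qed.

(** For i < j, the chain is y_i < x_(i+1) <= x_j <= y_j. *)
Lemma interlaced_chamber (N : nat) (y : {ffun 'I_N -> nat})
    (x : {ffun 'I_N.+1 -> nat}) :
  chamber N.+1 x -> interlaced y x -> chamber N y.
Proof.
move=> xW /forallP yx i j ltij.
have /andP[_ yi] := yx i; have /andP[xj _] := yx j.
apply: leq_trans yi (leq_trans _ xj).
have [lt|] := ltnP (lift ord0 i) (widen_ord (leqnSn N) j); first exact/ltnW/xW.
move=> ge; suff -> : lift ord0 i = widen_ord (leqnSn N) j by [].
by apply/val_inj/eqP; rewrite eqn_leq ge andbT.
Qed.

Lemma chamber_le_max (N : nat) (x : {ffun 'I_N.+1 -> nat}) (j : 'I_N.+1) :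
  chamber N.+1 x -> (x j <= x ord_max)%N.
Proof.
move=> xW; have [->//|jN] := eqVneq j ord_max.
by apply/ltnW/xW; rewrite ltn_neqAle -ltnS ltn_ord andbT.
Qed.

(** Interlacing bounds every coordinate of y by the last one of x, so the sum fits in a cube over a
    finite type, as [det_sum_cols] requires. Cube points that do not interlace contribute 0 through
    [Lambda]. *)
Lemma sum_interlaced (R : realType) (lam : nat -> R) (N : nat)
    (x : {ffun 'I_N.+1 -> nat}) (h : {ffun 'I_N -> nat} -> R) :
  chamber N.+1 x ->
  \sum_(y \in chamber N) (Lambda lam x y * h y) =
  \sum_(f : {ffun 'I_N -> 'I_(x ord_max)})
    (let y := [ffun j => val (f j)] in Lambda lam x y * h y).
Proof.
move=> xW.
pose y_of (f : {ffun 'I_N -> 'I_(x ord_max)}) := [ffun j => val (f j)].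
have y_of_inj : injective y_of.
  by move=> f g /ffunP fg; apply/ffunP => j; have := fg j; rewrite !ffunE => /val_inj.
pose r := [seq y <- [seq y_of f | f : {ffun 'I_N -> 'I_(x ord_max)}] | interlaced y x].
have r_uniq : uniq r by rewrite filter_uniq // map_inj_uniq // enum_uniq.
have mem_r y : interlaced y x -> y \in r.
  move=> yx; rewrite mem_filter yx /=; apply/mapP.
  have lt j : (y j < x ord_max)%N.
    by have /andP[_ /leq_trans] := forallP yx j; apply; apply: chamber_le_max.
  exists [ffun j => Ordinal (lt j)]; first by rewrite mem_enum.
  by apply/ffunP => j; rewrite !ffunE.
rewrite -(fsbig_widen [set` r]); first last.
- move=> y [_ /= /negP yr]; rewrite /Lambda; case: (boolP (interlaced y x)) => [/mem_r|_].
    by rewrite (negPf yr).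
  by rewrite mulr0 mul0r.
- by move=> y /=; rewrite mem_filter => /andP[/(interlaced_chamber _ _ _ xW)].
rewrite -fsbig_seq // big_filter big_mkcond big_image /=; apply: eq_bigr => f _.
by case: ifPn => // /negPf yx; rewrite /Lambda yx mulr0 mul0r.
Qed.

(** The bound [m] gives all columns one common summation range; the indicator removes the pieces
    below [a] and from [b] on. *)
Lemma Ifun_diff (R : realType) (lam : nat -> R) (i a b m : nat) :
  (a <= b <= m)%N ->
  \sum_(t < m) (if (a <= t < b)%N then 1 / lam t * Ifun lam i t else 0) =
  Ifun lam i.+1 b - Ifun lam i.+1 a.
Proof.
move=> /andP[ab bm] /=; rewrite (big_cat_nat (leq0n a) ab) /= addrAC subrr add0r.
rewrite -(big_mkord xpredT
  (fun t => if (a <= t < b)%N then 1 / lam t * Ifun lam i t else 0)).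
rewrite (big_cat_nat (leq0n b) bm) (big_cat_nat (leq0n a) ab) /=.
rewrite big_nat big1 => [|t /andP[_ ta]]; last by rewrite leqNgt ta.
rewrite [X in _ + X]big_nat [X in _ + X]big1 => [|t /andP[bt _]]; last first.
  by rewrite (ltnNge t) bt andbF.
by rewrite add0r addr0 big_nat [RHS]big_nat; apply: eq_bigr => t ->.
Qed.

Theorem lemma2p11 (R : realType) (lam : nat -> R)
    (lam_gt0 : forall y : nat, 0 < lam y)
    (inf_gt0 : (0%:E < ereal_inf (range (fun y : nat => (lam y)%:E)))%E)
    (sup_lty : (ereal_sup (range (fun y : nat => (lam y)%:E)) < +oo)%E)
    (N : nat) (N_ge1 : (1 <= N)%N)
    (x : {ffun 'I_N -> nat}) (x_in : x \in chamber N) :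
  hfun lam x = \det (\matrix_(i < N, j < N) Ifun lam i (x j)).
Proof.
case: N N_ge1 x x_in => // N _; elim: N => [|N IH] x /set_mem xW.
  by rewrite det_mx11 mxE.
rewrite det_row1_col_diff => [|j]; last by rewrite mxE.
rewrite [LHS](_ : _ = \sum_(y \in chamber N.+1)
  (Lambda lam x y * \det (\matrix_(i, j) Ifun lam i (y j)))); last first.
  by apply: eq_fsbigr => y yW; congr (_ * _); exact: IH.
rewrite sum_interlaced //.
(* The box condition is moved into the entries: column j vanishes outside its own interval [x_j,
   x_(j+1)). *)
pose F (i j : 'I_N.+1) (t : 'I_(x ord_max)) :=
  if (x (widen_ord (leqnSn N.+1) j) <= t < x (lift ord0 j))%N
  then 1 / lam t * Ifun lam i t else 0.
transitivity (\det (\matrix_(i, j) \sum_t F i j t)); last first.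
  congr (\det _); apply/matrixP => i j; rewrite !mxE Ifun_diff //.
  by apply/andP; split; [exact/ltnW/xW | exact: chamber_le_max].
rewrite det_sum_cols; apply: eq_bigr => f _ /=.
set y := [ffun j => val (f j)].
(* Weight and indicator do not depend on the row, so they factor out of column j. *)
have -> : \matrix_(i, j) F i j (f j) = \matrix_(i, j)
    ((1 / lam (y j) * (x (widen_ord (leqnSn N.+1) j) <= y j < x (lift ord0 j))%:R)
      * Ifun lam i (y j)).
  apply/matrixP => i j; rewrite !mxE /F !ffunE.
  by case: ifP; rewrite ?mulr1 // mulr0 mul0r.
rewrite det_scale_cols big_split /Lambda /=; congr (_ * _ * _).
(* The product of the coordinate indicators is the indicator of interlacing: one failing coordinate
   gives a zero factor. *)
rewrite /interlaced; case: (boolP [forall i, _]) => [/forallP yx | ].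
  by rewrite big1 // => j _; rewrite yx.
by rewrite negb_forall => /existsP[j /negPf yx]; rewrite (bigD1 j) //= yx mul0r.
Qed.
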